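(* Let $\nu:\Omega\to\mathbb S^2_1$ be a harmonic immersion with extended frame $\hat F$, and let $\mu\in\mathbb R\setminus\{0,\pm1\}$. Then $$g^\mu:=\hat F|_{\lambda=\mu}\,\hat F|_{\lambda=1}^{-1}$$ is a timelike immersion $\Omega\to\mathbb H^3_1$ with Gauss map $\nu$, for which $(x,y)$ are asymptotic coordinates, of constant extrinsic curvature $$K+1=\Big(\frac{1+\mu}{1-\mu}\Big)^2;$$ with $\rho=\tfrac{1+\mu}{1-\mu}$ it satisfies $$(g^\mu)^{-1}dg^\mu=\frac{[\nu,\nu_x]}{2(1+\rho)}\,dx+\frac{[\nu,\nu_y]}{2(1-\rho)}\,dy.$$ Moreover $\mu>0$ gives $|\rho|>1$, that is $K>0$, and $\mu<0$ gives $|\rho|<1$, that is $-1<K<0$.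
   Context: Ambient space. On the space $\mathfrak{gl}(2,\mathbb R)$ of real $2\times2$ matrices let $\langle X,Y\rangle=-\tfrac12\operatorname{tr}(X\bar Y)$, where $\bar Y=(\operatorname{tr}Y)\mathrm{Id}-Y$; then $\langle X,X\rangle=-\det X$. Anti-de Sitter 3-space is $\mathbb H^3_1=\{X:\langle X,X\rangle=-1\}=SL(2,\mathbb R)$ with the induced Lorentzian metric. On $\mathfrak{sl}(2,\mathbb R)$, $\langle X,Y\rangle=\tfrac12\operatorname{tr}(XY)$; put $\mathbb S^2_1=\{X\in\mathfrak{sl}(2,\mathbb R):\langle X,X\rangle=1\}$, $e_1=\begin{pmatrix}0&-1\\1&0\end{pmatrix}$, $e_2=\begin{pmatrix}0&1\\1&0\end{pmatrix}$, $e_3=\begin{pmatrix}-1&0\\0&1\end{pmatrix}$, $\mathrm{Ad}_FX=FXF^{-1}$, $\mathfrak k=\mathbb Re_3$, $\mathfrak p=\operatorname{span}(e_1,e_2)$. All maps are smooth; $\Omega\subset\mathbb R^2$ is a domain (connected open set) with coordinates $(x,y)$, regarded as null coordinates of a Lorentz structure; $\nu$ is harmonic if and only if $[\nu,\nu_{xy}]=0$. A frame of $\nu$ is a map $F:\Omega\to SL(2,\mathbb R)$ with $\nu=\mathrm{Ad}_Fe_3$; write $F^{-1}F_x=\beta_0+\beta_1$, $F^{-1}F_y=\gamma_0+\gamma_{-1}$ with $\beta_0,\gamma_0\in\mathfrak k$ and $\beta_1,\gamma_{-1}\in\mathfrak p$. An extended frame of the harmonic map $\nu$ is a family $\hat F|_\lambda:\Omega\to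 SL(2,\mathbb R)$, $\lambda\in\mathbb R\setminus\{0\}$, with $\hat F|_{\lambda=1}=F$ a frame of $\nu$ and $$\hat F^{-1}d\hat F=\hat\alpha^\lambda:=(\beta_0+\lambda\beta_1)\,dx+(\gamma_0+\lambda^{-1}\gamma_{-1})\,dy .$$ An immersion $f:\Omega\to\mathbb H^3_1$ is timelike if the induced metric $I$ is Lorentzian; it has Gauss map $\nu$ if $N=f\nu$ is a unit normal ($\langle N,N\rangle=1$, $N$ orthogonal to $f,f_x,f_y$). The second fundamental form $II$ has coefficients $L=\langle f_{xx},N\rangle$, $M=\langle f_{xy},N\rangle$, $\mathcal N=\langle f_{yy},N\rangle$; $(x,y)$ are asymptotic if $L=\mathcal N=0$ (and $II$ is Lorentzian). The Gaussian curvature $K$ is given by $K+1=\det II/\det I$, and $K+1$ is the extrinsic curvature. *)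

(* Defs.v *)
From HB Require Import structures.
From mathcomp Require Import all_boot all_order all_algebra.
From mathcomp Require Import all_classical all_reals all_analysis.

Set Implicit Arguments.
Unset Strict Implicit.
Unset Printing Implicit Defensive.

Import Order.TTheory GRing.Theory Num.Theory.
Import numFieldNormedType.Exports.

Local Open Scope classical_set_scope.
Local Open Scope ring_scope.

(* Maps defined on a subset Omega of the plane are represented by total maps
   on R * R, about which only the behaviour on Omega matters; Omega is open
   throughout, so that derivatives at points of Omega are unaffected by the
   values outside Omega. *)

Section Calculus.
Context {R : realType} {W : normedModType R}.
Implicit Types (Omega : set (R * R)) (f : R * R -> W).

Definition Dx f : R * R -> W := 'D_((1, 0) : R * R) f.
Definition Dy f : R * R -> W := 'D_((0, 1) : R * R) f.

Fixpoint Ck (n : nat) Omega f : Prop :=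
  if n is m.+1 then
    [/\ forall p, Omega p -> differentiable f p,
        Ck m Omega (Dx f) & Ck m Omega (Dy f)]
  else forall p, Omega p -> {for p, continuous f}.

Definition smooth Omega f : Prop := forall n, Ck n Omega f.

Definition immersion Omega f : Prop :=
  smooth Omega f /\ forall p, Omega p -> injective ('d f p).

End Calculus.

Section Matrices.
Context {R : realType}.
Implicit Types (X Y F B : 'M[R]_2).

Definition mx2 (a b c d : R) : 'M[R]_2 :=
  \matrix_(i, j) if i == 0 then if j == 0 then a else b
                 else if j == 0 then c else d.

Definition bar Y : 'M[R]_2 := (\tr Y)%:M - Y.

(* If \tr Y = 0 then bar Y = - Y, so that ip X Y = 2^-1 * \tr (X *m Y). *)
Definition ip X Y : R := - 2^-1 * \tr (X *m bar Y).

Definition lie X Y : 'M[R]_2 := X *m Y - Y *m X.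

Definition Ad F X : 'M[R]_2 := F *m X *m invmx F.

Definition SL2 : set 'M[R]_2 := [set X | \det X = 1].
Definition H31 : set 'M[R]_2 := [set X | ip X X = -1].
Definition S21 : set 'M[R]_2 := [set X | \tr X = 0 /\ ip X X = 1].

Definition e1 : 'M[R]_2 := mx2 0 (-1) 1 0.
Definition e2 : 'M[R]_2 := mx2 0 1 1 0.
Definition e3 : 'M[R]_2 := mx2 (-1) 0 0 1.

Definition kk : set 'M[R]_2 := [set X | exists a, X = a *: e3].
Definition pp : set 'M[R]_2 := [set X | exists a b, X = a *: e1 + b *: e2].

(* B is the Gram matrix of a symmetric bilinear form of signature (1, 1). *)
Definition lorentzian B : Prop :=
  exists2 P : 'M[R]_2, P \in unitmx & P^T *m B *m P = mx2 (-1) 0 0 1.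

End Matrices.

Section Surfaces.
Context {R : realType}.
Implicit Types (Omega : set (R * R)) (nu f F A B : R * R -> 'M[R]_2).

Definition maps_to Omega f (S : set 'M[R]_2) : Prop :=
  forall p, Omega p -> S (f p).

(* F^-1 dF = A dx + B dy on Omega *)
Definition maurer_cartan Omega F A B : Prop :=
  forall p, Omega p -> forall v : R * R,
    invmx (F p) *m 'd F p v = v.1 *: A p + v.2 *: B p.

Definition is_harmonic Omega nu : Prop :=
  forall p, Omega p -> lie (nu p) (Dy (Dx nu) p) = 0.

Definition is_frame Omega nu F : Prop :=
  [/\ smooth Omega F, maps_to Omega F SL2
    & forall p, Omega p -> nu p = Ad (F p) e3].

(* Since the sum of kk and pp is direct, beta0, beta1, gamma0 and gamma1 are
   determined on Omega by the frame hF 1. *)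
Definition extended_frame Omega nu (hF : R -> R * R -> 'M[R]_2) : Prop :=
  [/\ forall lambda, lambda != 0 ->
        smooth Omega (hF lambda) /\ maps_to Omega (hF lambda) SL2,
      is_frame Omega nu (hF 1)
    & exists beta0 beta1 gamma0 gamma1 : R * R -> 'M[R]_2,
      [/\ maps_to Omega beta0 kk /\ maps_to Omega gamma0 kk,
          maps_to Omega beta1 pp /\ maps_to Omega gamma1 pp,
          forall p, Omega p ->
            invmx (hF 1 p) *m Dx (hF 1) p = beta0 p + beta1 p /\
            invmx (hF 1 p) *m Dy (hF 1) p = gamma0 p + gamma1 p
        & forall lambda, lambda != 0 ->
            maurer_cartan Omega (hF lambda)
              (fun p => beta0 p + lambda *: beta1 p)
              (fun p => gamma0 p + lambda^-1 *: gamma1 p)]].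

Definition first_form f (p : R * R) : 'M[R]_2 :=
  mx2 (ip (Dx f p) (Dx f p)) (ip (Dx f p) (Dy f p))
      (ip (Dy f p) (Dx f p)) (ip (Dy f p) (Dy f p)).

Definition unit_normal f nu (p : R * R) : 'M[R]_2 := f p *m nu p.

Definition coefL f nu (p : R * R) : R := ip (Dx (Dx f) p) (unit_normal f nu p).
Definition coefM f nu (p : R * R) : R := ip (Dy (Dx f) p) (unit_normal f nu p).
Definition coefN f nu (p : R * R) : R := ip (Dy (Dy f) p) (unit_normal f nu p).

Definition second_form f nu (p : R * R) : 'M[R]_2 :=
  mx2 (coefL f nu p) (coefM f nu p) (coefM f nu p) (coefN f nu p).

Definition timelike_immersion Omega f : Prop :=
  [/\ immersion Omega f, maps_to Omega f H31
    & forall p, Omega p -> lorentzian (first_form f p)].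

Definition has_gauss_map Omega f nu : Prop :=
  forall p, Omega p ->
    let N := unit_normal f nu p in
    [/\ ip N N = 1, ip N (f p) = 0, ip N (Dx f p) = 0 & ip N (Dy f p) = 0].

Definition asymptotic_coordinates Omega f nu : Prop :=
  forall p, Omega p ->
    [/\ coefL f nu p = 0, coefN f nu p = 0 & lorentzian (second_form f nu p)].

(* The extrinsic curvature is gauss_curvature f nu p + 1. *)
Definition gauss_curvature f nu (p : R * R) : R :=
  \det (second_form f nu p) / \det (first_form f p) - 1.

End Surfaces.

(* Main.v *)
(* Write [F] and [G] for the frames at [lambda = 1] and [lambda = mu].  For
   a constant matrix [C], the map [G C F^-1] has differential
   [G (alpha^mu C - C alpha^1) F^-1].  Taking [C = 1] gives
     [dg = G ((mu - 1) beta_1 dx + (mu^-1 - 1) gamma_1 dy) F^-1],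
   and, since [e3] commutes with [kk] and anticommutes with [pp], taking
   [C = e3] gives the differential of the normal [N = g nu = G e3 F^-1],
     [dN = G ((mu + 1) beta_1 dx + (mu^-1 + 1) gamma_1 dy) e3 F^-1],
   which for [mu = 1] is that of [nu].  As [X |-> G X F^-1] is an isometry,
   both fundamental forms are then computed in [pp], the second one from
   [<g_uv, N> = - <g_u, N_v>].  They are nondegenerate because
   [delta = <beta_1, gamma_1 e3>] is, up to sign, the determinant of
   [(beta_1, gamma_1)] in the basis [(e1, e2)], which is nonzero since [nu]
   is an immersion. *)
Require Import Defs.
From HB Require Import structures.
From mathcomp Require Import all_boot all_order all_algebra.
From mathcomp Require Import all_classical all_reals all_analysis.
From mathcomp Require Import ring.

Set Implicit Arguments.
Unset Strict Implicit.
Unset Printing Implicit Defensive.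

Import Order.TTheory GRing.Theory Num.Theory.
Import numFieldNormedType.Exports.

Local Open Scope classical_set_scope.
Local Open Scope ring_scope.

(** * Explicit algebra of two-by-two matrices and of the form [ip] *)

Section TwoByTwo.
Context {R : realType}.
Implicit Types (X Y F G : 'M[R]_2).

Lemma mx2_eta X : X = mx2 (X 0 0) (X 0 1) (X 1 0) (X 1 1).
Proof.
apply/matrixP => -[[|[|//]] ilt] [[|[|//]] jlt]; rewrite mxE /=;
  by congr (X _ _); apply: val_inj.
Qed.

Lemma mulmx2 (a b c d a' b' c' d' : R) :
  mx2 a b c d *m mx2 a' b' c' d' =
  mx2 (a * a' + b * c') (a * b' + b * d') (c * a' + d * c') (c * b' + d * d').
Proof.
by rewrite [LHS]mx2_eta !mxE !big_ord_recl !big_ord0 !mxE /= !addr0.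
Qed.

Lemma addmx2 (a b c d a' b' c' d' : R) :
  mx2 a b c d + mx2 a' b' c' d' = mx2 (a + a') (b + b') (c + c') (d + d').
Proof. by rewrite [LHS]mx2_eta !mxE. Qed.

Lemma oppmx2 (a b c d : R) : - mx2 a b c d = mx2 (- a) (- b) (- c) (- d).
Proof. by rewrite [LHS]mx2_eta !mxE. Qed.

Lemma scalemx2 (k a b c d : R) :
  k *: mx2 a b c d = mx2 (k * a) (k * b) (k * c) (k * d).
Proof. by rewrite [LHS]mx2_eta !mxE. Qed.

Lemma scalarmx2 (k : R) : k%:M = mx2 k 0 0 k.
Proof. by rewrite [LHS]mx2_eta !mxE. Qed.

Lemma trmx2 (a b c d : R) : (mx2 a b c d)^T = mx2 a c b d.
Proof. by rewrite [LHS]mx2_eta !mxE. Qed.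

Lemma mxtrace2 (a b c d : R) : \tr (mx2 a b c d) = a + d.
Proof. by rewrite /mxtrace !big_ord_recl big_ord0 !mxE /= addr0. Qed.

Lemma barmx2 (a b c d : R) : bar (mx2 a b c d) = mx2 d (- b) (- c) a.
Proof.
by rewrite /bar mxtrace2 scalarmx2 oppmx2 addmx2; congr mx2; ring.
Qed.

Lemma detmx2 (a b c d : R) : \det (mx2 a b c d) = a * d - b * c.
Proof.
rewrite (expand_det_row _ 0) !big_ord_recl big_ord0 /cofactor !det_mx11 !mxE /=.
by rewrite expr0 expr1; ring.
Qed.

Lemma ipmx2 (a b c d a' b' c' d' : R) :
  ip (mx2 a b c d) (mx2 a' b' c' d') =
  - 2^-1 * (a * d' - b * c' - c * b' + d * a').
Proof. by rewrite /ip barmx2 mulmx2 mxtrace2; congr (_ * _); ring. Qed.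

(** After [mx2_eta], rewriting with this list reduces a matrix identity to identities between
    entries, within reach of [ring] and [field]. *)
Definition mx2E := (mulmx2, addmx2, oppmx2, scalemx2, scalarmx2, trmx2,
  mxtrace2, barmx2, detmx2, ipmx2).

Lemma ipC X Y : ip X Y = ip Y X.
Proof.
by rewrite (mx2_eta X) (mx2_eta Y) !mx2E; ring.
Qed.

Lemma bar_mulmx X Y : bar (X *m Y) = bar Y *m bar X.
Proof.
by rewrite (mx2_eta X) (mx2_eta Y) !mx2E; congr mx2; ring.
Qed.

Lemma barK : involutive (@bar R).
Proof. by move=> X; rewrite (mx2_eta X) !mx2E !opprK. Qed.

Lemma mul_bar_mx F : \det F = 1 -> bar F *m F = 1%:M.
Proof.
by rewrite (mx2_eta F) !mx2E => e; congr mx2; first [ring | rewrite -[RHS]e; ring].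
Qed.

Lemma mul_mx_bar F : \det F = 1 -> F *m bar F = 1%:M.
Proof. by move=> /mul_bar_mx/mulmx1C. Qed.

Lemma SL2_unitmx F : \det F = 1 -> F \in unitmx.
Proof. by move=> e; rewrite unitmxE e unitr1. Qed.

(** [bar] is the adjugate. Unlike those of [invmx], its entries are linear in the entries of the
    matrix, so this is the form in which inverses of frames get differentiated. *)
Lemma invmx_bar F : \det F = 1 -> invmx F = bar F.
Proof.
by move=> e; rewrite -[RHS](mulKmx (SL2_unitmx e)) mul_mx_bar// mulmx1.
Qed.

Lemma bar_traceless X : \tr X = 0 -> bar X = - X.
Proof. by move=> e; rewrite /bar e -scalemx1 scale0r sub0r. Qed.

(** [bar] reverses products, so [bar F *m F] appears inside the trace and, after a cyclic shift, so
    does [bar G *m G]; both are the identity. *)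
Lemma ip_mulmx F G X Y : \det F = 1 -> \det G = 1 ->
  ip (G *m X *m bar F) (G *m Y *m bar F) = ip X Y.
Proof.
move=> dF dG; rewrite /ip !bar_mulmx barK; congr (_ * _).
rewrite !mulmxA -(mulmxA _ (bar F)) mul_bar_mx// mulmx1.
by rewrite mxtrace_mulC !mulmxA mul_bar_mx// mul1mx.
Qed.

Lemma lie_conj F X Y : \det F = 1 ->
  lie (F *m X *m bar F) (F *m Y *m bar F) = F *m lie X Y *m bar F.
Proof.
move=> dF; have barFM Z W : F *m Z *m bar F *m (F *m W *m bar F) =
    F *m (Z *m W) *m bar F.
  by rewrite !mulmxA -(mulmxA _ (bar F) F) mul_bar_mx// mulmx1.
by rewrite /lie !barFM -(mulmxBl _ _ (bar F)) -(mulmxBr F).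
Qed.

Lemma mulmx_bar_inj F G X Y : \det F = 1 -> \det G = 1 ->
  G *m X *m bar F = G *m Y *m bar F -> X = Y.
Proof.
move=> dF dG /(congr1 (fun Z => bar G *m Z *m F)).
by rewrite -!mulmxA !mul_bar_mx// !mulmx1 !mulmxA mul_bar_mx// !mul1mx.
Qed.

(** A Gram matrix factors this way when the columns of [T] are coordinates in an orthonormal basis
    of signature (-1, 1); the change of basis required by [lorentzian] is then the inverse of
    [T]. *)
Lemma lorentzian_congr (B T : 'M[R]_2) : T \in unitmx ->
  B = T^T *m mx2 (-1) 0 0 1 *m T -> lorentzian B.
Proof.
move=> Tu ->; exists (invmx T); first by rewrite unitmx_inv.
by rewrite !mulmxA -trmx_mul mulmxV// trmx1 mul1mx -mulmxA mulmxV// mulmx1.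
Qed.

Lemma lorentzian_offdiag (m : R) : m != 0 -> lorentzian (mx2 0 m m 0).
Proof.
(* The rows of the witness are the linear forms in [2 m u v = - (u - m v / 2)^2 + (u + m v /
   2)^2]. *)
move=> m0; apply: (@lorentzian_congr _ (mx2 1 (- (m / 2)) 1 (m / 2))).
  by rewrite unitmxE !mx2E unitfE (_ : _ - _ = m)//; field.
by rewrite !mx2E; congr mx2; field.
Qed.

End TwoByTwo.

(** * Differentiation of matrix-valued maps entry by entry *)

Section EntrywiseCalculus.
Context {R : realType} {V : normedModType R}.
Implicit Types (p v : V).

Lemma is_derive_mxP m n (M : V -> 'M[R]_(m, n)) p v dM :
  is_derive p v M dM <->
  forall i j, is_derive p v (fun q => M q i j) (dM i j).
Proof.
split=> [[Mv <-] i j|Mv].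
  have /derivable_mxP Mv' := Mv.
  by split; [exact: Mv'|rewrite (derive_mx Mv) mxE].
have dM' : derivable M p v by apply/derivable_mxP => i j; case: (Mv i j).
split=> //; rewrite (derive_mx dM'); apply/matrixP => i j.
by rewrite mxE; case: (Mv i j).
Qed.

Lemma differentiable_mxP m n (M : V -> 'M[R]_(m, n)) p :
  differentiable M p <-> forall i j, differentiable (fun q => M q i j) p.
Proof.
split=> [dM i j|dM].
  exact: (differentiable_comp dM (differentiable_coord _ _ _)).
(* Over the elementary matrices, [M] is a finite sum of scalar functions times constants. *)
have -> : M = \sum_(i < m) \sum_(j < n) (fun q => M q i j *: delta_mx i j).
  apply/funext => q; rewrite [LHS]matrix_sum_delta fct_sumE.
  by apply: eq_bigr => i _; rewrite fct_sumE.
apply: differentiable_sum => i; apply: differentiable_sum => j.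
apply: differentiableZl; exact: dM.
Qed.

Lemma is_derive_mulmx m n k (A : V -> 'M[R]_(m, n)) (B : V -> 'M[R]_(n, k))
    p v dA dB :
  is_derive p v A dA -> is_derive p v B dB ->
  is_derive p v (fun q => A q *m B q) (dA *m B p + A p *m dB).
Proof.
move=> /is_derive_mxP hA /is_derive_mxP hB; apply/is_derive_mxP => i j.
have -> : (fun q => (A q *m B q) i j) =
    \sum_(l < n) ((fun q => A q i l) * (fun q => B q l j)).
  by apply/funext => q; rewrite mxE fct_sumE.
apply: is_derive_eq; rewrite !mxE -big_split; apply: eq_bigr => l _.
by rewrite /GRing.scale /= addrC [dA i l * _]mulrC.
Qed.

Lemma is_derive_mxtrace n (M : V -> 'M[R]_n) p v dM :
  is_derive p v M dM -> is_derive p v (fun q => \tr (M q)) (\tr dM).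
Proof.
move=> /is_derive_mxP hM; rewrite /mxtrace.
have -> : (fun q => \sum_i M q i i) = \sum_i (fun q => M q i i).
  by apply/funext => q; rewrite fct_sumE.
exact: is_derive_sum.
Qed.

Lemma is_derive_bar (F : V -> 'M[R]_2) p v dF :
  is_derive p v F dF -> is_derive p v (fun q => bar (F q)) (bar dF).
Proof.
move=> /is_derive_mxP hF; apply/is_derive_mxP => i j.
have -> : (fun q => bar (F q) i j) =
    (fun q => mx2 (F q 1 1) (- F q 0 1) (- F q 1 0) (F q 0 0) i j).
  by apply/funext => q; rewrite {1}[F q]mx2_eta barmx2.
rewrite [dF]mx2_eta barmx2.
by case: i => [[|[|//]] ilt]; case: j => [[|[|//]] jlt]; rewrite mxE /=;
  under eq_fun do rewrite mxE /=; try exact: is_deriveN; exact: hF.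
Qed.

Lemma is_derive_ip (X Y : V -> 'M[R]_2) p v dX dY :
  is_derive p v X dX -> is_derive p v Y dY ->
  is_derive p v (fun q => ip (X q) (Y q)) (ip dX (Y p) + ip (X p) dY).
Proof.
move=> hX hY; rewrite /ip -mulrDr -mxtraceD.
have h := is_derive_mxtrace (is_derive_mulmx hX (is_derive_bar hY)).
exact: (is_deriveZ (- 2^-1) h).
Qed.

End EntrywiseCalculus.

(** * Locality and closure properties of the classes [Ck] and of smooth maps *)

Section Smoothness.
Context {R : realType}.
Implicit Types (Omega : set (R * R)).

Lemma near_eq_open {T : topologicalType} {U : Type} (Omega : set T) (f g : T -> U) p :
  open Omega -> Omega p -> (forall q, Omega q -> f q = g q) ->
  \near p, f p = g p.
Proof.
move=> oO Op fg; near=> q; apply: fg; near: q; exact: open_nbhs_nbhs.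
Unshelve. all: by end_near. Qed.

Lemma near_eq_differentiable {V W : normedModType R} (f g : V -> W) p :
  (\near p, f p = g p) -> differentiable f p -> differentiable g p.
Proof.
move=> fg df.
(* The first-order expansion of [f] at [p] is also one of [g]; uniqueness of the differential then
   identifies ['d g p] with ['d f p]. *)
have dgE : g \o shift p = cst (g p) + 'd f p +o_ 0 id.
  apply/eqaddoP => e e0; have /eqaddoP/(_ e e0) fe := diff_locally df.
  have := fg; rewrite (near_shift 0) subr0 => fg0.
  near=> h; rewrite /= !fctE /= -(nbhs_singleton fg).
  rewrite -(_ : f (h + p) = g (h + p)); first by near: h.
  by near: h.
have dfc : continuous ('d f p) by exact: diff_continuous.
by apply/diff_locallyP; rewrite (diff_unique dfc dgE).
Unshelve. all: by end_near. Qed.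

Lemma Ck_differentiable {W : normedModType R} n Omega (f : R * R -> W) p :
  Ck n.+1 Omega f -> Omega p -> differentiable f p.
Proof. by case=> df _ _; exact: df. Qed.

(** On an open set derivatives depend only on germs. This is what lets the inductions below replace
    a derivative by a formula valid only on [Omega]. *)
Lemma Ck_eq {W : normedModType R} n Omega (f g : R * R -> W) : open Omega ->
  (forall p, Omega p -> f p = g p) -> Ck n Omega f -> Ck n Omega g.
Proof.
move=> oO; elim: n f g => [|n IHn] f g fg /=.
  move=> cf p Op; have fgp := near_eq_open oO Op fg.
  have cfp : f @ p --> f p := cf p Op.
  rewrite (fg p Op) in cfp; apply: cvg_trans cfp; exact: near_eq_cvg.
case=> df Dxf Dyf; split.
- move=> p Op; apply: near_eq_differentiable (df p Op).
  exact: near_eq_open oO Op fg.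
- apply: IHn Dxf => p Op; apply: near_eq_derive.
  exact: near_eq_open oO Op fg.
- apply: IHn Dyf => p Op; apply: near_eq_derive.
  exact: near_eq_open oO Op fg.
Qed.

Lemma Ck_pred {W : normedModType R} n Omega (f : R * R -> W) :
  Ck n.+1 Omega f -> Ck n Omega f.
Proof.
elim: n f => [|n IHn] f.
  by case=> df _ _ p Op; exact: differentiable_continuous (df p Op).
by case=> df /IHn Dxf /IHn Dyf.
Qed.

Lemma Ck_cst {W : normedModType R} n Omega (a : W) :
  open Omega -> Ck n Omega (fun=> a : W).
Proof.
move=> oO; elim: n a => [|n IHn] a; first by move=> p _; exact: cst_continuous.
split; first by move=> p _; exact: differentiable_cst.
- by apply: Ck_eq (IHn 0) => // p _; rewrite /Dx derive_cst.
- by apply: Ck_eq (IHn 0) => // p _; rewrite /Dy derive_cst.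
Qed.

Lemma CkD {W : normedModType R} n Omega (f g : R * R -> W) : open Omega ->
  Ck n Omega f -> Ck n Omega g -> Ck n Omega (fun p => f p + g p).
Proof.
move=> oO; elim: n f g => [|n IHn] f g.
  by move=> cf cg p Op; apply: cvgD; [exact: cf|exact: cg].
case=> df Dxf Dyf [dg Dxg Dyg]; split.
- by move=> p Op; apply: differentiableD; [exact: df|exact: dg].
- apply: Ck_eq (IHn _ _ Dxf Dxg) => // p Op.
  by rewrite /Dx deriveD//; apply: diff_derivable; [exact: df|exact: dg].
- apply: Ck_eq (IHn _ _ Dyf Dyg) => // p Op.
  by rewrite /Dy deriveD//; apply: diff_derivable; [exact: df|exact: dg].
Qed.

Lemma CkM n Omega (f g : R * R -> R) : open Omega ->
  Ck n Omega f -> Ck n Omega g -> Ck n Omega (fun p => f p * g p).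
Proof.
move=> oO; elim: n f g => [|n IHn] f g.
  by move=> cf cg p Op; apply: cvgM; [exact: cf|exact: cg].
move=> hf hg; have [df Dxf Dyf] := hf; have [dg Dxg Dyg] := hg.
have deriveE v p : Omega p ->
    'D_v (f * g) p = f p * 'D_v g p + g p * 'D_v f p.
  by move=> Op; rewrite deriveM//; apply: diff_derivable; [exact: df|exact: dg].
split.
- by move=> p Op; apply: differentiableM; [exact: df|exact: dg].
(* The Leibniz rule leaves one factor undifferentiated; [Ck_pred] lowers its order to that of the
   induction hypothesis. *)
- apply: Ck_eq (CkD oO (IHn _ _ (Ck_pred hf) Dxg)
    (IHn _ _ (Ck_pred hg) Dxf)) => // p Op.
  by rewrite /Dx deriveE.
- apply: Ck_eq (CkD oO (IHn _ _ (Ck_pred hf) Dyg)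
    (IHn _ _ (Ck_pred hg) Dyf)) => // p Op.
  by rewrite /Dy deriveE.
Qed.

Lemma Ck_sum {W : normedModType R} n Omega (I : finType) (f : I -> R * R -> W) :
  open Omega -> (forall i, Ck n Omega (f i)) ->
  Ck n Omega (fun p => \sum_i f i p).
Proof.
move=> oO hf; rewrite -fct_sumE; apply: (big_ind (Ck n Omega)) => //.
  exact: Ck_cst.
by move=> g h hg hh; exact: CkD.
Qed.

Lemma smooth_differentiable {W : normedModType R} Omega (f : R * R -> W) p :
  smooth Omega f -> Omega p -> differentiable f p.
Proof. by move=> /(_ 1); exact: Ck_differentiable. Qed.

Lemma smooth_Dx {W : normedModType R} Omega (f : R * R -> W) :
  smooth Omega f -> smooth Omega (Dx f).
Proof. by move=> sf n; case: (sf n.+1). Qed.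

Lemma smooth_Dy {W : normedModType R} Omega (f : R * R -> W) :
  smooth Omega f -> smooth Omega (Dy f).
Proof. by move=> sf n; case: (sf n.+1). Qed.

Lemma smooth_eq {W : normedModType R} Omega (f g : R * R -> W) : open Omega ->
  (forall p, Omega p -> f p = g p) -> smooth Omega f -> smooth Omega g.
Proof. by move=> oO fg sf n; exact: Ck_eq (sf n). Qed.

Lemma smooth_mxP m k Omega (M : R * R -> 'M[R]_(m, k)) : open Omega ->
  smooth Omega M <-> forall i j, smooth Omega (fun p => M p i j).
Proof.
move=> oO.
have deriveE v (N : R * R -> 'M[R]_(m, k)) p i j : differentiable N p ->
    'D_v N p i j = 'D_v (fun q => N q i j) p.
  by move=> dN; rewrite derive_mx ?mxE//; exact: diff_derivable.
split=> sM; last first.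
  (* The induction assumes full smoothness of the entries, not just order [n], so that the
     assumption passes to [Dx N] and [Dy N]. *)
  move=> n; elim: n M sM => [|n IHn] N sN;
      have dN p : Omega p -> differentiable N p
        by move=> Op; apply/differentiable_mxP => i j;
           exact: smooth_differentiable (sN i j) Op.
    by move=> p /dN; exact: differentiable_continuous.
  split=> //; apply: IHn => i j.
  - apply: smooth_eq (smooth_Dx (sN i j)) => // p Op.
    by rewrite /Dx deriveE//; exact: dN.
  - apply: smooth_eq (smooth_Dy (sN i j)) => // p Op.
    by rewrite /Dy deriveE//; exact: dN.
move=> i j n; elim: n M sM => [|n IHn] N sN;
    have dN p : Omega p -> differentiable (fun q => N q i j) p
      by move=> Op; have /differentiable_mxP := smooth_differentiable sN Op.
  by move=> p /dN; exact: differentiable_continuous.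
split=> //.
- apply: Ck_eq (IHn _ (smooth_Dx sN)) => // p Op.
  by rewrite /Dx deriveE//; exact: smooth_differentiable sN Op.
- apply: Ck_eq (IHn _ (smooth_Dy sN)) => // p Op.
  by rewrite /Dy deriveE//; exact: smooth_differentiable sN Op.
Qed.

Lemma smooth_mulmx m k l Omega (A : R * R -> 'M[R]_(m, k))
    (B : R * R -> 'M[R]_(k, l)) : open Omega ->
  smooth Omega A -> smooth Omega B -> smooth Omega (fun p => A p *m B p).
Proof.
move=> oO /(smooth_mxP _ oO) sA /(smooth_mxP _ oO) sB.
apply/smooth_mxP => // i j n.
have -> : (fun p => (A p *m B p) i j) =
    (fun p => \sum_h A p i h * B p h j) by apply/funext => p; rewrite mxE.
by apply: Ck_sum => // h; apply: CkM => //; [exact: sA|exact: sB].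
Qed.

Lemma smooth_bar Omega (F : R * R -> 'M[R]_2) : open Omega ->
  smooth Omega F -> smooth Omega (fun p => bar (F p)).
Proof.
move=> oO /(smooth_mxP _ oO) sF.
have sN i j : smooth Omega (fun p => - F p i j).
  move=> n; apply: (@Ck_eq _ _ _ (fun p => -1 * F p i j)) => //.
    by move=> p _; rewrite mulN1r.
  by apply: CkM => //; [exact: Ck_cst|exact: sF].
apply/smooth_mxP => // i j.
have -> : (fun p => bar (F p) i j) =
    (fun p => mx2 (F p 1 1) (- F p 0 1) (- F p 1 0) (F p 0 0) i j).
  by apply/funext => p; rewrite {1}[F p]mx2_eta barmx2.
by case: i => [[|[|//]] ilt]; case: j => [[|[|//]] jlt];
  under eq_fun do rewrite mxE /=; first [exact: sN | exact: sF].
Qed.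

End Smoothness.

(** * Differentials of the products [G C F^-1] of two frames *)

Section TwistedFrames.
Context {R : realType}.
Implicit Types (Omega : set (R * R)) (F G : R * R -> 'M[R]_2).

(** Since [bar A = - A] for traceless [A], the factor [bar F] has derivative [- A *m bar F], and the
    product rule concludes. *)
Lemma is_derive_twist F G (p v : R * R) (A B C : 'M[R]_2) :
  \det (F p) = 1 -> \tr A = 0 ->
  is_derive p v F (F p *m A) -> is_derive p v G (G p *m B) ->
  is_derive p v (fun q => G q *m C *m bar (F q))
    (G p *m (B *m C - C *m A) *m bar (F p)).
Proof.
move=> dF trA hF hG; have hC := is_derive_cst C p v.
apply: is_derive_eq (is_derive_mulmx (is_derive_mulmx hG hC) (is_derive_bar hF)) _.
rewrite /cst mulmx0 addr0 bar_mulmx (bar_traceless trA) mulNmx mulmxN !mulmxA.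
by rewrite -(mulmxBl _ _ (bar (F p))) (mulmxBr (G p)) !mulmxA.
Qed.

(** The [kk] parts cancel in both formulas, so only the [pp] parts need to be exposed. The second
    formula serves twice: at [l = mu] for the normal, at [l = 1] for [nu]. *)
Lemma extended_frame_derive Omega nu (hF : R -> R * R -> 'M[R]_2) :
  extended_frame Omega nu hF ->
  exists beta1 gamma1 : R * R -> 'M[R]_2,
  [/\ maps_to Omega beta1 pp, maps_to Omega gamma1 pp &
    forall l p v, l != 0 -> Omega p ->
    is_derive p v (fun q => hF l q *m bar (hF 1 q))
      (hF l p *m ((v.1 * (l - 1)) *: beta1 p + (v.2 * (l^-1 - 1)) *: gamma1 p)
        *m bar (hF 1 p)) /\
    is_derive p v (fun q => hF l q *m e3 *m bar (hF 1 q))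
      (hF l p *m (((v.1 * (l + 1)) *: beta1 p +
                   (v.2 * (l^-1 + 1)) *: gamma1 p) *m e3)
        *m bar (hF 1 p))].
Proof.
case=> hFS _ [b0 [b1 [c0 [c1 [[kb kc] [pb pc] _ mc]]]]].
exists b1, c1; split=> // l p v l0 Op.
have dhF k : k != 0 -> is_derive p v (hF k)
    (hF k p *m (v.1 *: (b0 p + k *: b1 p) + v.2 *: (c0 p + k^-1 *: c1 p))).
  move=> k0; have [sF SF] := hFS k k0.
  have dF := smooth_differentiable sF Op.
  (* The Maurer-Cartan equation is solved for the derivative, [dF = F alpha]. *)
  rewrite -mc// mulKVmx ?SL2_unitmx//; last exact: SF.
  by rewrite -deriveE//; exact/derivableP/diff_derivable.
have [x0 bE] := kb p Op; have [y0 cE] := kc p Op.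
have [x1 [x2 bE1]] := pb p Op; have [y1 [y2 cE1]] := pc p Op.
have [_ /(_ p Op) dF] := hFS 1 (oner_neq0 R).
move: (dhF 1 (oner_neq0 R)) (dhF l l0).
set A := _ + _ => hF1 hFl.
have trA : \tr A = 0.
  by rewrite /A bE cE bE1 cE1 /e1 /e2 /e3 !mx2E; ring.
split.
  have := is_derive_twist 1%:M dF trA hF1 hFl.
  under eq_fun do rewrite mulmx1.
  congr (is_derive _ _ _ (_ *m _ *m _)).
  rewrite mulmx1 mul1mx /A bE cE bE1 cE1 /e1 /e2 /e3 !mx2E.
  by congr mx2; rewrite invr1; ring.
have := is_derive_twist e3 dF trA hF1 hFl.
congr (is_derive _ _ _ (_ *m _ *m _)).
rewrite /A bE cE bE1 cE1 /e1 /e2 /e3 !mx2E.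
by congr mx2; rewrite invr1; ring.
Qed.

End TwistedFrames.

(** * Fundamental forms, curvature and Maurer-Cartan form of [g] *)

Theorem proposition4p8 (R : realType) (Omega : set (R * R))
    (Omega_open : open Omega) (Omega_connected : connected Omega)
    (nu : R * R -> 'M[R]_2)
    (nu_S21 : maps_to Omega nu S21)
    (nu_immersion : immersion Omega nu)
    (nu_harmonic : is_harmonic Omega nu)
    (hF : R -> R * R -> 'M[R]_2)
    (hF_extended : extended_frame Omega nu hF)
    (mu : R) (mu_neq0 : mu != 0) (mu_neq1 : mu != 1) (mu_neqN1 : mu != -1) :
  let g : R * R -> 'M[R]_2 := fun p => hF mu p *m invmx (hF 1 p) in
  let rho : R := (1 + mu) / (1 - mu) in
  [/\ timelike_immersion Omega g,
      has_gauss_map Omega g nu,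
      asymptotic_coordinates Omega g nu,
      forall p, Omega p ->
        gauss_curvature g nu p + 1 = rho ^+ 2
    & [/\ maurer_cartan Omega g
            (fun p => (2 * (1 + rho))^-1 *: lie (nu p) (Dx nu p))
            (fun p => (2 * (1 - rho))^-1 *: lie (nu p) (Dy nu p)),
          0 < mu -> 1 < `|rho| /\
            forall p, Omega p -> 0 < gauss_curvature g nu p
        & mu < 0 -> `|rho| < 1 /\
            forall p, Omega p -> -1 < gauss_curvature g nu p < 0]].
Proof.
move=> g rho; have oO := Omega_open.
have [beta1 [gamma1 [pb pc hderiv]]] := extended_frame_derive hF_extended.
have [hFS [_ _ nuE] _] := hF_extended.
have [sG SG] := hFS mu mu_neq0; have [sF SF] := hFS 1 (oner_neq0 R).
(* These equalities hold only on [Omega]; its openness lets them carry over to derivatives. *)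
have gE p : Omega p -> hF mu p *m bar (hF 1 p) = g p.
  by move=> Op; rewrite /g invmx_bar//; exact: SF.
have nuE' p : Omega p -> hF 1 p *m e3 *m bar (hF 1 p) = nu p.
  by move=> Op; rewrite nuE// /Ad invmx_bar//; exact: SF.
have NE p : Omega p -> hF mu p *m e3 *m bar (hF 1 p) = unit_normal g nu p.
  move=> Op; rewrite /unit_normal -gE// -nuE'// !mulmxA.
  by rewrite -(mulmxA _ (bar _)) mul_bar_mx ?mulmx1//; exact: SF.
have sg : smooth Omega g.
  by apply: smooth_eq gE _ => //; apply: smooth_mulmx => //; exact: smooth_bar.
have [snu inj_dnu] := nu_immersion.
have dg p v : Omega p -> 'D_v g p = hF mu p *m
    ((v.1 * (mu - 1)) *: beta1 p + (v.2 * (mu^-1 - 1)) *: gamma1 p) *m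
    bar (hF 1 p).
  move=> Op; have [h _] := hderiv mu p v mu_neq0 Op.
  by rewrite -(near_eq_derive v (near_eq_open oO Op gE)) derive_val.
have dnu p v : Omega p -> 'D_v nu p = hF 1 p *m
    ((v.1 *: beta1 p + v.2 *: gamma1 p) *m (2 *: e3)) *m bar (hF 1 p).
  move=> Op; have [_ h] := hderiv 1 p v (oner_neq0 R) Op.
  rewrite -(near_eq_derive v (near_eq_open oO Op nuE')) derive_val.
  rewrite -scalemxAr scalemxAl scalerDr !scalerA invr1.
  by rewrite ![_ * (1 + 1)]mulrC.
(* After removing the isometry, this says that [pp] is orthogonal to [e3]. *)
have normalP p v : Omega p -> ip ('D_v g p) (unit_normal g nu p) = 0.
  move=> Op; rewrite dg// -NE//.
  rewrite ip_mulmx; [|exact: SF|exact: SG].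
  have [x1 [x2 ->]] := pb p Op; have [y1 [y2 ->]] := pc p Op.
  by rewrite /e1 /e2 /e3 !mx2E /=; ring.
have second u v p : Omega p -> smooth Omega ('D_u g) ->
    ip ('D_v ('D_u g) p) (unit_normal g nu p) =
    - ip ((u.1 * (mu - 1)) *: beta1 p + (u.2 * (mu^-1 - 1)) *: gamma1 p)
         (((v.1 * (mu + 1)) *: beta1 p + (v.2 * (mu^-1 + 1)) *: gamma1 p)
           *m e3).
  move=> Op sDu; have [_ hN] := hderiv mu p v mu_neq0 Op.
  have hD : is_derive p v ('D_u g) ('D_v ('D_u g) p).
    exact/derivableP/diff_derivable/(smooth_differentiable sDu).
  have /@derive_val := is_derive_ip hD hN.
  (* By [normalP] the differentiated inner product vanishes near [p], so the two terms of its
     product rule are opposite. *)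
  rewrite (near_eq_derive (g := cst 0)); last first.
    apply: near_eq_open oO Op _ => q Oq /=.
    by rewrite NE// normalP.
  rewrite derive_cst dg// ip_mulmx; [|exact: SF|exact: SG].
  by rewrite NE// => /esym/eqP; rewrite addr_eq0 => /eqP.
have sgx := smooth_Dx sg; have sgy := smooth_Dy sg.
(* In coordinates [(x1, x2)] of [beta1] and [(y1, y2)] of [gamma1] this is [x1 * y2 - x2 * y1]. *)
pose delta p := 2^-1 * \tr (gamma1 p *m e3 *m beta1 p).
have delta_neq0 p : Omega p -> delta p != 0.
  move=> Op; have free_nu s t : s *: beta1 p + t *: gamma1 p = 0 ->
      s = 0 /\ t = 0.
    move=> st0; have dnup := smooth_differentiable snu Op.
    have D0 : 'D_((s, t) : R * R) nu p = 'D_(0 : R * R) nu p.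
      by rewrite derive0 dnu//= st0 mul0mx mulmx0 mul0mx.
    have : 'd nu p (s, t) = 'd nu p 0 :=
      etrans (esym (deriveE _ dnup)) (etrans D0 (deriveE _ dnup)).
    by move=> /(inj_dnu p Op) [-> ->].
  have [x1 [x2 bE]] := pb p Op; have [y1 [y2 cE]] := pc p Op.
  apply/eqP => d0; have d0' : x1 * y2 = x2 * y1.
    apply/eqP; rewrite -subr_eq0 -d0 /delta bE cE /e1 /e2 /e3 !mx2E.
    by apply/eqP; field.
  have z0 : mx2 0 0 0 0 = 0 :> 'M[R]_2.
    by rewrite [RHS]mx2_eta !mxE.
  (* If [delta] vanishes, [y1 beta1 - x1 gamma1] and [y2 beta1 - x2 gamma1] are both zero.
     Independence then forces [beta1 = 0], which contradicts independence itself. *)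
  have [y10 /eqP] : y1 = 0 /\ - x1 = 0.
    apply: free_nu; rewrite bE cE /e1 /e2 !mx2E -z0; congr mx2; ring: d0'.
  rewrite oppr_eq0 => /eqP x10.
  have [y20 /eqP] : y2 = 0 /\ - x2 = 0.
    apply: free_nu; rewrite bE cE /e1 /e2 !mx2E -z0; congr mx2; ring: d0'.
  rewrite oppr_eq0 => /eqP x20.
  have [/eqP] : (1 : R) = 0 /\ (0 : R) = 0.
    by apply: free_nu; rewrite bE x10 x20 !scale0r !addr0 scaler0.
  by rewrite oner_eq0.
have mu1 : mu - 1 != 0 by rewrite subr_eq0.
have mu1' : 1 - mu != 0 by rewrite subr_eq0 eq_sym.
have muN1 : 1 + mu != 0 by rewrite addrC -(opprK 1) subr_eq0.
have mui1 : mu^-1 - 1 != 0.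
  by rewrite (_ : _ - _ = (1 - mu) / mu) ?mulf_neq0 ?invr_eq0//; field.
have muiN1 : mu^-1 + 1 != 0.
  by rewrite (_ : _ + _ = (1 + mu) / mu) ?mulf_neq0 ?invr_eq0//; field.
(* On [pp] the form [<X, Y e3>] is alternating: the two diagonal coefficients vanish and the mixed
   one is a multiple of [delta]. *)
have LE p : Omega p -> coefL g nu p = 0.
  move=> Op; apply: etrans (second (1, 0) (1, 0) p Op sgx) _.
  have [x1 [x2 ->]] := pb p Op; have [y1 [y2 ->]] := pc p Op.
  by rewrite /e1 /e2 /e3 !mx2E /=; ring.
have NNE p : Omega p -> Defs.coefN g nu p = 0.
  move=> Op; apply: etrans (second (0, 1) (0, 1) p Op sgy) _.
  have [x1 [x2 ->]] := pb p Op; have [y1 [y2 ->]] := pc p Op.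
  by rewrite /e1 /e2 /e3 !mx2E /=; ring.
have ME p : Omega p -> Defs.coefM g nu p = - (mu - 1) * (mu^-1 + 1) * delta p.
  move=> Op; rewrite /delta; apply: etrans (second (1, 0) (0, 1) p Op sgx) _.
  have [x1 [x2 ->]] := pb p Op; have [y1 [y2 ->]] := pc p Op.
  by rewrite /e1 /e2 /e3 !mx2E /=; ring.
have IIE p : Omega p -> second_form g nu p =
    mx2 0 (- (mu - 1) * (mu^-1 + 1) * delta p)
        (- (mu - 1) * (mu^-1 + 1) * delta p) 0.
  by move=> Op; rewrite /second_form LE// NNE// ME.
have IE p : Omega p -> exists2 T : 'M[R]_2,
    first_form g p = T^T *m mx2 (-1) 0 0 1 *m T &
    \det T = (mu - 1) * (mu^-1 - 1) * delta p.
  move=> Op; rewrite /first_form /Dx /Dy !dg//= !ip_mulmx;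
    do ?[exact: SF | exact: SG].
  rewrite /delta.
  have [x1 [x2 ->]] := pb p Op; have [y1 [y2 ->]] := pc p Op.
  (* The columns are the coordinates in [(e1, e2)], orthonormal with signs (-1, 1), of the [pp]
     parts of [g_x] and [g_y]. *)
  exists (mx2 ((mu - 1) * x1) ((mu^-1 - 1) * y1)
              ((mu - 1) * x2) ((mu^-1 - 1) * y2)).
    by rewrite /e1 /e2 !mx2E; congr mx2; field.
  by rewrite /e1 /e2 /e3 !mx2E; field.
have KE p : Omega p -> gauss_curvature g nu p + 1 = rho ^+ 2.
  move=> Op; have [T IT dT] := IE p Op.
  (* Both determinants are minus a square, of [coefM] and of [\det T]; [delta] cancels in the
     quotient. *)
  rewrite /gauss_curvature subrK IIE// IT !det_mulmx det_tr dT !detmx2 /rho.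
  have d0 := delta_neq0 p Op.
  by field; rewrite mu_neq0 mu1' mu1 d0.
(* As [K = rho ^+ 2 - 1], this shows that the sign of [K] is that of [mu]. *)
have rho2 : rho ^+ 2 - 1 = mu * (2 / (1 - mu)) ^+ 2 by rewrite /rho; field.
have sq_gt0 : 0 < (2 / (1 - mu)) ^+ 2.
  by rewrite lt0r sqr_ge0 expf_neq0// mulf_neq0// ?invr_eq0// pnatr_eq0.
have rho_gt0 : 0 < rho ^+ 2.
  by rewrite lt0r sqr_ge0 expf_neq0// mulf_neq0// invr_eq0.
split; [| | |exact: KE|].
- split.
  + split=> [|p Op v w]; first exact: sg.
    have dgp := smooth_differentiable sg Op.
    rewrite -!deriveE// !dg// => /(mulmx_bar_inj (SF p Op) (SG p Op)) vw.
    have [x1 [x2 bE]] := pb p Op; have [y1 [y2 cE]] := pc p Op.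
    (* Pairing with [gamma1 e3] kills [gamma1], and the pairing twisted by [e3] against [beta1]
       kills [beta1]; each isolates one coefficient, up to [delta]. *)
    have pair1 s t : 2^-1 * \tr (gamma1 p *m e3 *m
        (s *: beta1 p + t *: gamma1 p)) = s * delta p.
      by rewrite /delta bE cE /e1 /e2 /e3 !mx2E; field.
    have pair2 s t : 2^-1 * \tr ((s *: beta1 p + t *: gamma1 p) *m e3 *m
        beta1 p) = t * delta p.
      by rewrite /delta bE cE /e1 /e2 /e3 !mx2E; field.
    have d0 := delta_neq0 p Op.
    have vw1 : v.1 = w.1.
      apply/(mulIf mu1)/(mulIf d0).
      by rewrite -(pair1 _ (v.2 * (mu^-1 - 1))) vw pair1.
    have vw2 : v.2 = w.2.
      apply/(mulIf mui1)/(mulIf d0).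
      by rewrite -(pair2 (v.1 * (mu - 1))) vw pair2.
    by move: v w vw1 vw2 {vw} => [v1 v2] [w1 w2] /= -> ->.
  + move=> p Op; rewrite /H31 /= -gE// -(mulmx1 (hF mu p)).
    rewrite ip_mulmx; [|exact: SF|exact: SG].
    by rewrite !mx2E; field.
  + move=> p Op; have [T IT dT] := IE p Op.
    apply: lorentzian_congr IT; rewrite unitmxE dT unitfE.
    exact: mulf_neq0 (mulf_neq0 mu1 mui1) (delta_neq0 p Op).
- move=> p Op; split.
  + rewrite -NE// ip_mulmx; [|exact: SF|exact: SG].
    by rewrite /e3 !mx2E; field.
  + rewrite -NE// -gE// -[in X in ip _ X](mulmx1 (hF mu p)).
    rewrite ip_mulmx; [|exact: SF|exact: SG].
    by rewrite /e3 !mx2E; field.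
  + by rewrite ipC normalP.
  + by rewrite ipC normalP.
- move=> p Op; rewrite LE// NNE// IIE//; split=> //.
  apply: lorentzian_offdiag.
  by rewrite mulf_neq0 ?delta_neq0// mulf_neq0// oppr_eq0.
- split.
  + move=> p Op v.
    have dgp := smooth_differentiable sg Op.
    rewrite -deriveE// dg//.
    have ug : g p \in unitmx.
      rewrite /g unitmx_mul unitmx_inv.
      by rewrite (SL2_unitmx (SG p Op)) (SL2_unitmx (SF p Op)).
    set X := _ + _.
    (* Writing [G = g F] moves the differential of [g] to the left-invariant form [g (F X F^-1)]. *)
    have -> : hF mu p *m X *m bar (hF 1 p) =
        g p *m (hF 1 p *m X *m bar (hF 1 p)).
      rewrite -gE// !mulmxA -(mulmxA _ (bar _) (hF 1 p)).
      by rewrite mul_bar_mx ?mulmx1//; exact: SF.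
    rewrite mulKmx// /Dx /Dy !dnu// -nuE'// !lie_conj; do ?[exact: SF].
    rewrite /= !scale1r !scale0r addr0 add0r !scalerA.
    rewrite !(scalemxAl _ _ (bar (hF 1 p))) !(scalemxAr _ (hF 1 p)).
    rewrite -(mulmxDl _ _ (bar (hF 1 p))) -(mulmxDr (hF 1 p)).
    congr (_ *m _ *m _).
    (* For [X] in [pp], [[e3, 2 X e3] = - 4 X]; the factors [mu - 1] and [mu^-1 - 1] of [dg] thus
       require these two values. *)
    have r1 : (2 * (1 + rho))^-1 = (1 - mu) / 4.
      have -> : 1 + rho = 2 / (1 - mu) by rewrite /rho; field.
      by field.
    have r2 : (2 * (1 - rho))^-1 = (1 - mu^-1) / 4.
      have -> : 1 - rho = - 2 * mu / (1 - mu) by rewrite /rho; field.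
      by field; rewrite mu_neq0.
    rewrite r1 r2 /X.
    have [x1 [x2 ->]] := pb p Op; have [y1 [y2 ->]] := pc p Op.
    by rewrite /lie /e1 /e2 /e3 !mx2E; congr mx2; field.
  + move=> mu_gt0.
    have rho_gt1 : 1 < rho ^+ 2 by rewrite -subr_gt0 rho2 mulr_gt0.
    split.
      by rewrite -(ltr_pXn2r (ltn0Sn 1)) ?nnegrE// expr1n real_normK ?num_real.
    by move=> p Op; rewrite -(ltrD2r 1) add0r KE.
  + move=> mu_lt0.
    have rho_lt1 : rho ^+ 2 < 1 by rewrite -subr_lt0 rho2 nmulr_rlt0.
    split.
      by rewrite -(ltr_pXn2r (ltn0Sn 1)) ?nnegrE// expr1n real_normK ?num_real.
    move=> p Op; apply/andP; split.
      by rewrite -(ltrD2r 1) addNr KE.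
    by rewrite -(ltrD2r 1) add0r KE.
Qed.
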